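(* Let $A,B:[0,1]\to\mathbb{R}$ be smooth functions and consider the Abel equation $$\frac{dx}{dt}=A(t)x^3+B(t)x^2,\qquad (t,x)\in[0,1]\times\mathbb{R}.$$ Assume that there exist two real numbers $a$ and $b$ such that the function $aA(t)+bB(t)$ does not vanish identically on $[0,1]$ and does not change sign on $[0,1]$. Then the equation has at most one non-zero periodic orbit. Furthermore, when this periodic orbit exists, it is hyperbolic.
   Context: A periodic orbit of the equation is a solution $x(t)$ defined on all of $[0,1]$ with $x(0)=x(1)$; $x\equiv 0$ is always one, and a non-zero periodic orbit is one different from $x\equiv0$. The Poincaré map is $\Pi(x_0)=x(1;x_0)$, where $x(t;x_0)$ is the solution with $x(0;x_0)=x_0$ (defined for those $x_0$ whose solution exists on $[0,1]$). A periodic orbit with initial condition $x_0$ is hyperbolic if $\Pi'(x_0)\neq 1$. *)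

(* Defs.v *)
From Stdlib Require Import Reals.
From Coquelicot Require Import Coquelicot.
Open Scope R_scope.

Definition smooth_on01 (f : R -> R) : Prop :=
  exists g : R -> R,
    (forall (n : nat) (t : R), ex_derive_n g n t) /\
    (forall t, 0 <= t <= 1 -> g t = f t).

Definition in01 (t : R) : Prop := 0 <= t <= 1.

Definition has_deriv01 (x : R -> R) (t v : R) : Prop :=
  filterlim (fun s => (x s - x t) / (s - t))
    (within (fun s => in01 s /\ s <> t) (locally t)) (locally v).

Definition abel_solution (A B : R -> R) (x : R -> R) : Prop :=
  forall t, in01 t -> has_deriv01 x t (A t * (x t) ^ 3 + B t * (x t) ^ 2).

Definition periodic_orbit (A B : R -> R) (x : R -> R) : Prop :=
  abel_solution A B x /\ x 0 = x 1.

Definition nonzero_on01 (x : R -> R) : Prop :=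
  exists t, in01 t /\ x t <> 0.

(* The periodic orbit through x0 is hyperbolic: the Poincaré map
   Pi(y) = x(1; y) is defined on a neighbourhood of x0, is differentiable
   at x0, and Pi'(x0) <> 1.  (Solutions are unique since the vector field
   is locally Lipschitz, so P below is the Poincaré map near x0.) *)
Definition hyperbolic_at (A B : R -> R) (x0 : R) : Prop :=
  exists (eps : R) (P : R -> R) (d : R),
    0 < eps /\
    (forall y, Rabs (y - x0) < eps ->
       exists x, abel_solution A B x /\ x 0 = y /\ x 1 = P y) /\
    is_derive P x0 d /\ d <> 1.

(* Main.v *)
(* Write D = a A + b B, which we may assume nonnegative, and v = a - b x along a non-zero
   periodic orbit x (which never vanishes).  Since v' = A x^2 v - x^2 D, the function
   v exp(- int A x^2) is monotone and not constant, so v has constant sign and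
   int A x^2 <> 0.  As int (A x^2 + B x) = int x'/x = 0, the derivative of the Poincaré map,
   exp (int (3 A x^2 + 2 B x)), equals exp (int A x^2) <> 1.
   If G' = 1 / (x^2 (a - b x)), then along two orbits x and y,
   (G(x) - G(y))' = (x - y) D / ((a - b x) (a - b y)), which has constant sign unless x = y,
   whereas G(x) - G(y) is periodic. *)
Require Import Defs.
From Stdlib Require Import Reals Lra Lia.
From Coquelicot Require Import Coquelicot.
Open Scope R_scope.

(** * Derivatives on the unit interval *)

Lemma has_deriv01E (x : R -> R) (t v : R) :
  has_deriv01 x t v <->
  forall eps, 0 < eps -> exists delta, 0 < delta /\
    forall s, in01 s -> s <> t -> Rabs (s - t) < delta ->
      Rabs ((x s - x t) / (s - t) - v) < eps.
Proof.
split.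
- intros H eps He.
  destruct (H (fun y => Rabs (y - v) < eps)) as [d Hd].
  { exists (mkposreal eps He). intros y Hy. exact Hy. }
  exists d. split; [apply cond_pos|].
  intros s Hs Hst Hsd. apply (Hd s); [exact Hsd|tauto].
- intros H P [eps HP].
  destruct (H eps (cond_pos eps)) as [d [Hd0 Hd]].
  exists (mkposreal d Hd0). intros s Hs [H1 H2].
  apply HP. apply (Hd s); auto.
Qed.

Lemma is_deriveE (x : R -> R) (t v : R) :
  is_derive x t v <->
  forall eps, 0 < eps -> exists delta, 0 < delta /\
    forall s, s <> t -> Rabs (s - t) < delta ->
      Rabs ((x s - x t) / (s - t) - v) < eps.
Proof.
rewrite is_derive_Reals. split.
- intros H eps He. destruct (H eps He) as [d Hd].
  exists d. split; [apply cond_pos|]. intros s Hs Hsd.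
  assert (Hh : s - t <> 0) by lra.
  specialize (Hd (s - t) Hh Hsd).
  now replace (t + (s - t)) with s in Hd by ring.
- intros H eps He. destruct (H eps He) as [d [Hd0 Hd]].
  exists (mkposreal d Hd0). intros h Hh Hhd.
  assert (Hs : t + h <> t) by lra.
  specialize (Hd (t + h) Hs).
  replace (t + h - t) with h in Hd by ring. now apply Hd.
Qed.

Lemma is_derive_has_deriv01 (x y : R -> R) (t v : R) :
  in01 t -> (forall s, in01 s -> y s = x s) -> is_derive x t v -> has_deriv01 y t v.
Proof.
intros Ht Hxy Hx. apply has_deriv01E. intros eps He.
destruct (proj1 (is_deriveE x t v) Hx eps He) as [d [Hd0 Hd]].
exists d. split; [exact Hd0|]. intros s Hs Hst Hsd.
rewrite (Hxy s Hs), (Hxy t Ht). now apply Hd.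
Qed.

(** Truncation to [[-r, r]]. Composing a polynomial field with it makes the field globally Lipschitz
    and leaves it unchanged along small solutions. *)
Definition clamp (r t : R) : R := Rmax (- r) (Rmin r t).

Lemma clamp_lipschitz (r s t : R) : Rabs (clamp r s - clamp r t) <= Rabs (s - t).
Proof.
unfold clamp, Rmax, Rmin.
repeat destruct Rle_dec; unfold Rabs; repeat destruct Rcase_abs; lra.
Qed.

Lemma clamp_bound (r t : R) : 0 <= r -> Rabs (clamp r t) <= r.
Proof.
intros Hr; unfold clamp, Rmax, Rmin.
repeat destruct Rle_dec; apply Rabs_le; lra.
Qed.

Lemma clamp_id (r t : R) : Rabs t <= r -> clamp r t = t.
Proof.
intros H. apply Rabs_le_between in H.
unfold clamp, Rmax, Rmin; repeat destruct Rle_dec; lra.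
Qed.

Lemma continuousE (f : R -> R) (t : R) :
  continuous f t <->
  forall eps, 0 < eps -> exists delta, 0 < delta /\
    forall s, Rabs (s - t) < delta -> Rabs (f s - f t) < eps.
Proof.
split.
- intros H eps He.
  destruct (H (fun y => Rabs (y - f t) < eps)) as [d Hd].
  { exists (mkposreal eps He). intros y Hy. exact Hy. }
  exists d. split; [apply cond_pos|]. exact Hd.
- intros H P [eps HP].
  destruct (H eps (cond_pos eps)) as [d [Hd0 Hd]].
  exists (mkposreal d Hd0). intros s Hs. apply HP. apply (Hd s); auto.
Qed.

(** The nearest-point retraction onto [0,1]. Precomposing with it extends a function by constants,
    so that two-sided continuity on the line makes sense for it. *)
Definition proj01 (t : R) : R := Rmax 0 (Rmin 1 t).

Lemma proj01_in (t : R) : in01 (proj01 t).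
Proof. unfold in01, proj01, Rmax, Rmin; repeat destruct Rle_dec; lra. Qed.

Lemma proj01_id (t : R) : in01 t -> proj01 t = t.
Proof. unfold in01, proj01, Rmax, Rmin; repeat destruct Rle_dec; lra. Qed.

Lemma proj01_lipschitz (s t : R) : Rabs (proj01 s - proj01 t) <= Rabs (s - t).
Proof.
unfold proj01, Rmax, Rmin.
repeat destruct Rle_dec; unfold Rabs; repeat destruct Rcase_abs; lra.
Qed.

(** Near [proj01 t] the difference quotients of [x] within [0,1] are bounded by
    [Rabs (v (proj01 t)) + 1], and [proj01] is nonexpansive. *)
Lemma continuous_comp_proj01 (x : R -> R) (v : R -> R) :
  (forall t, in01 t -> has_deriv01 x t (v t)) ->
  forall t, continuous (fun s => x (proj01 s)) t.
Proof.
intros Hx t. apply continuousE. intros eps He.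
set (t' := proj01 t).
destruct (proj1 (has_deriv01E _ _ _) (Hx t' (proj01_in t)) 1 Rlt_0_1) as [d [Hd0 Hd]].
set (M := Rabs (v t') + 1).
assert (HM : 0 < M) by (unfold M; pose proof (Rabs_pos (v t')); lra).
assert (Hq : 0 < eps / M) by (apply Rdiv_lt_0_compat; lra).
exists (Rmin d (eps / M)). split; [now apply Rmin_pos|].
intros s Hs.
assert (Hs1 : Rabs (s - t) < d) by (eapply Rlt_le_trans; [exact Hs|apply Rmin_l]).
assert (Hs2 : Rabs (s - t) < eps / M) by (eapply Rlt_le_trans; [exact Hs|apply Rmin_r]).
pose proof (proj01_lipschitz s t) as HL. fold t' in HL |- *.
set (s' := proj01 s) in *.
destruct (Req_dec s' t') as [->|Hne].
{ rewrite Rminus_diag, Rabs_R0. exact He. }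
specialize (Hd s' (proj01_in s) Hne ltac:(lra)).
set (q := (x s' - x t') / (s' - t')) in *.
assert (Hxq : x s' - x t' = q * (s' - t')) by (unfold q; field; lra).
rewrite Hxq, Rabs_mult.
assert (HqM : Rabs q <= M).
{ unfold M. replace q with (v t' + (q - v t')) by ring.
  eapply Rle_trans; [apply Rabs_triang|lra]. }
apply Rle_lt_trans with (M * Rabs (s - t)).
- apply Rmult_le_compat; try apply Rabs_pos; auto.
- apply Rmult_lt_compat_l with (1 := HM) in Hs2.
  replace (M * (eps / M)) with eps in Hs2 by (field; lra). exact Hs2.
Qed.

Lemma is_derive_RInt_continuous (k : R -> R) (t : R) :
  (forall t, continuous k t) -> is_derive (fun t => RInt k 0 t) t (k t).
Proof.
intros Hk. apply is_derive_RInt with (a := 0); [|apply Hk].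
apply filter_forall. intros y. apply (RInt_correct (V := R_CompleteNormedModule)).
apply (ex_RInt_continuous (V := R_CompleteNormedModule)). intros; apply Hk.
Qed.

Lemma continuous_primitive (k : R -> R) :
  (forall t, continuous k t) ->
  exists K : R -> R, K 0 = 0 /\ forall t, is_derive K t (k t).
Proof.
intros Hk. exists (fun t => RInt k 0 t). split.
- apply (RInt_point (V := R_CompleteNormedModule)).
- intros t. now apply is_derive_RInt_continuous.
Qed.

Lemma is_derive_continuous (F : R -> R) (t v : R) : is_derive F t v -> continuous F t.
Proof. intros H. apply (ex_derive_continuous F). now exists v. Qed.

Lemma mean_value (F f : R -> R) (s t : R) :
  (forall r, s < r < t -> is_derive F r (f r)) ->
  (forall r, s <= r <= t -> continuous F r) ->
  s <= t -> exists c, s <= c <= t /\ F t - F s = f c * (t - s).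
Proof.
intros Hd Hc Hst.
destruct (MVT_gen F s t f) as [c [Hc' E]].
- intros r. rewrite Rmin_left, Rmax_right by lra. apply Hd.
- intros r. rewrite Rmin_left, Rmax_right by lra. intros Hr.
  apply continuity_pt_filterlim. now apply Hc.
- rewrite Rmin_left, Rmax_right in Hc' by lra. now exists c.
Qed.

Lemma mean_value01 (F f : R -> R) :
  (forall t, in01 t -> is_derive F t (f t)) ->
  forall s t, 0 <= s -> s <= t -> t <= 1 ->
  exists c, in01 c /\ F t - F s = f c * (t - s).
Proof.
intros HF s t Hs Hst Ht.
destruct (mean_value F f s t) as [c [Hc E]]; auto.
- intros r Hr. apply HF. unfold in01; lra.
- intros r Hr. apply is_derive_continuous with (f r). apply HF. unfold in01; lra.
- exists c. split; [unfold in01; lra|exact E].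
Qed.

Lemma nonneg_derive_nondecreasing (F f : R -> R) :
  (forall t, in01 t -> is_derive F t (f t)) -> (forall t, in01 t -> 0 <= f t) ->
  forall s t, 0 <= s -> s <= t -> t <= 1 -> F s <= F t.
Proof.
intros HF Hf s t Hs Hst Ht.
destruct (mean_value01 F f HF s t Hs Hst Ht) as [c [Hc E]].
specialize (Hf c Hc). nra.
Qed.

(** Equal end values would make the nondecreasing [F] constant on [0,1]. Its difference quotients at
    [t0] would then vanish, against [f t0 > 0]. *)
Lemma nonneg_derive_lt (F f : R -> R) (t0 : R) :
  (forall t, in01 t -> is_derive F t (f t)) -> (forall t, in01 t -> 0 <= f t) ->
  in01 t0 -> f t0 <> 0 -> F 0 < F 1.
Proof.
intros HF Hf Ht0 Hft0.
pose proof (nonneg_derive_nondecreasing F f HF Hf) as Hm.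
destruct (Rle_lt_or_eq_dec (F 0) (F 1)) as [H|H]; [apply Hm; lra|exact H|exfalso].
assert (Hc : forall t, in01 t -> F t = F 0).
{ intros t [Ht1 Ht2]. apply Rle_antisym; [rewrite H|]; apply Hm; lra. }
assert (Hp : 0 < f t0) by (specialize (Hf t0 Ht0); lra).
destruct (proj1 (is_deriveE _ _ _) (HF t0 Ht0) (f t0) Hp) as [d [Hd0 Hd]].
assert (exists s, in01 s /\ s <> t0 /\ Rabs (s - t0) < d) as [s [Hs [Hst Hsd]]].
(* Since [t0] may be an endpoint, the test point lies towards the other half of the interval;
   [h <= 1 / 2] keeps it inside. *)
{ set (h := Rmin (d / 2) (1 / 2)).
  assert (Hh : 0 < h) by (apply Rmin_pos; lra).
  assert (Hh1 : h <= d / 2) by apply Rmin_l.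
  assert (Hh2 : h <= 1 / 2) by apply Rmin_r.
  unfold in01 in *.
  destruct (Rle_dec t0 (1 / 2)).
  - exists (t0 + h). repeat split; try lra. apply Rabs_def1; lra.
  - exists (t0 - h). repeat split; try lra. apply Rabs_def1; lra. }
specialize (Hd s Hst Hsd). rewrite (Hc s Hs), (Hc t0 Ht0) in Hd.
unfold Rdiv in Hd. rewrite Rminus_diag, Rmult_0_l, Rminus_0_l, Rabs_Ropp, Rabs_right in Hd; lra.
Qed.

Lemma derive_bound (F f : R -> R) (c : R) :
  (forall t, in01 t -> is_derive F t (f t)) -> (forall t, in01 t -> Rabs (f t) <= c) ->
  forall t, in01 t -> Rabs (F t - F 0) <= c.
Proof.
intros HF Hf t [Ht0 Ht1].
destruct (mean_value01 F f HF 0 t) as [r [Hr E]]; try lra.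
rewrite E, Rminus_0_r, Rabs_mult, (Rabs_right t) by lra.
specialize (Hf r Hr). pose proof (Rabs_pos (f r)). nra.
Qed.

Lemma zero_derive_constant (F : R -> R) :
  (forall t, in01 t -> is_derive F t 0) -> forall t, in01 t -> F t = F 0.
Proof.
intros HF t [Ht0 Ht1].
destruct (mean_value01 F (fun _ => 0) HF 0 t) as [r [Hr E]]; lra.
Qed.

Lemma continuous01_bounded (f : R -> R) :
  (forall t, continuous f t) ->
  exists m, in01 m /\ forall t, in01 t -> Rabs (f t) <= Rabs (f m).
Proof.
intros Hf.
destruct (continuity_ab_maj (fun t => Rabs (f t)) 0 1) as [m [H1 H2]]; [lra| |].
- intros c _. apply continuity_pt_filterlim.
  apply (continuous_comp f Rabs); [apply Hf|apply continuous_Rabs].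
- exists m. split; auto.
Qed.

Lemma nonexpansive_continuous (f : R -> R) :
  (forall s t, Rabs (f s - f t) <= Rabs (s - t)) -> forall t, continuous f t.
Proof.
intros H t. apply continuousE. intros eps He. exists eps. split; [exact He|].
intros s Hs. specialize (H s t). lra.
Qed.

Lemma is_derive_comp_proj01 (x : R -> R) (t v : R) :
  0 < t < 1 -> has_deriv01 x t v -> is_derive (fun s => x (proj01 s)) t v.
Proof.
intros Ht Hx. apply is_deriveE. intros eps He.
destruct (proj1 (has_deriv01E _ _ _) Hx eps He) as [d [Hd0 Hd]].
exists (Rmin d (Rmin t (1 - t))). split.
{ repeat apply Rmin_pos; lra. }
intros s Hst Hs.
pose proof (Rmin_l d (Rmin t (1 - t))). pose proof (Rmin_r d (Rmin t (1 - t))).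
pose proof (Rmin_l t (1 - t)). pose proof (Rmin_r t (1 - t)).
assert (Hs' : Rabs (s - t) < Rmin t (1 - t)) by lra.
apply Rabs_def2 in Hs'.
rewrite !proj01_id by (unfold in01; lra).
apply Hd; unfold in01; lra.
Qed.

(** This turns the one-sided derivatives at 0 and 1 into two-sided ones. The difference between [x]
    composed with [proj01] and a primitive of [v] has zero derivative inside the interval and is
    continuous up to its ends, hence is constant there. *)
Lemma has_deriv01_primitive (x v : R -> R) :
  (forall t, continuous v t) -> (forall t, in01 t -> has_deriv01 x t (v t)) ->
  exists X, (forall t, in01 t -> X t = x t) /\ forall t, is_derive X t (v t).
Proof.
intros Hv Hx.
destruct (continuous_primitive v Hv) as [K [HK0 HK]].
exists (fun t => x 0 + K t). split.
- intros t Ht.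
  destruct (mean_value (fun s => x (proj01 s) - K s) (fun _ => 0) 0 t) as [c [_ E]].
  + intros r Hr. replace 0 with (v r - v r) by ring.
    apply (is_derive_minus (fun s => x (proj01 s)) K).
    * apply is_derive_comp_proj01; [|apply Hx]; unfold in01 in *; lra.
    * apply HK.
  + intros r _. apply (continuous_minus (fun s => x (proj01 s)) K).
    * now apply (continuous_comp_proj01 x v).
    * apply is_derive_continuous with (v r). apply HK.
  + apply Ht.
  + rewrite (proj01_id t Ht), (proj01_id 0) in E by (unfold in01; lra). lra.
- intros t. replace (v t) with (0 + v t) by ring.
  apply (is_derive_plus (fun _ => x 0) K); [|apply HK].
  apply (is_derive_const (K := R_AbsRing) (V := R_NormedModule)).
Qed.

Lemma continuous_Rplus (f g : R -> R) (t : R) :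
  continuous f t -> continuous g t -> continuous (fun s => f s + g s) t.
Proof. intros Hf Hg. now apply (continuous_plus f g). Qed.

Lemma continuous_Rmult (f g : R -> R) (t : R) :
  continuous f t -> continuous g t -> continuous (fun s => f s * g s) t.
Proof. intros Hf Hg. now apply (continuous_mult f g). Qed.

Lemma continuous_Rpow (f : R -> R) (n : nat) (t : R) :
  continuous f t -> continuous (fun s => f s ^ n) t.
Proof.
intros Hf. induction n as [|n IH]; simpl.
- apply continuous_const.
- now apply continuous_Rmult.
Qed.

Ltac continuity_of_terms :=
  lazymatch goal with
  | |- continuous (fun _ => ?c) _ => apply continuous_const
  | |- continuous (fun t => _ + _) _ => apply continuous_Rplus; continuity_of_terms
  | |- continuous (fun t => _ * _) _ => apply continuous_Rmult; continuity_of_terms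
  | |- continuous (fun t => _ ^ _) _ => apply continuous_Rpow; continuity_of_terms
  | H : forall t, continuous ?f t |- continuous ?f _ => apply H
  | H : forall t, continuous ?f t |- continuous (fun t => ?f t) _ => apply H
  | _ => idtac
  end.

Definition regular_solution (A B x : R -> R) : Prop :=
  (forall t, continuous x t) /\
  forall t, in01 t -> is_derive x t (A t * x t ^ 3 + B t * x t ^ 2).

(** Putting the extension [xc] into the right-hand side gives a velocity that is continuous on the
    whole line, as [has_deriv01_primitive] requires. *)
Lemma abel_solution_regular (A B x : R -> R) :
  (forall t, continuous A t) -> (forall t, continuous B t) ->
  abel_solution A B x ->
  exists X, regular_solution A B X /\ forall t, in01 t -> X t = x t.
Proof.
intros HA HB Hx.
pose proof (continuous_comp_proj01 x _ Hx) as Hc.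
set (xc := fun s => x (proj01 s)) in Hc.
destruct (has_deriv01_primitive x (fun t => A t * xc t ^ 3 + B t * xc t ^ 2))
  as [X [HX HdX]].
- intros t. continuity_of_terms.
- intros t Ht. unfold xc. rewrite (proj01_id t Ht). now apply Hx.
- exists X. split; [|exact HX]. split.
  + intros t. eapply is_derive_continuous. apply HdX.
  + intros t Ht. rewrite (HX t Ht).
    replace (x t) with (xc t) by (unfold xc; now rewrite (proj01_id t Ht)). apply HdX.
Qed.

Lemma is_derive_Rplus (f g : R -> R) (t u v : R) :
  is_derive f t u -> is_derive g t v -> is_derive (fun s => f s + g s) t (u + v).
Proof. intros Hf Hg. now apply (is_derive_plus f g). Qed.

Lemma is_derive_Rmult (f g : R -> R) (t u v : R) :
  is_derive f t u -> is_derive g t v ->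
  is_derive (fun s => f s * g s) t (u * g t + f t * v).
Proof. intros Hf Hg. apply (is_derive_mult f g); auto. intros; apply Rmult_comm. Qed.

(** The range of integration has length at most 1, so the constant is preserved. Lipschitz constant
    1/2 of a field thus becomes contraction factor 1/2 of its integral operator. *)
Lemma RInt_diff_bound (k l : R -> R) (c : R) :
  (forall t, continuous k t) -> (forall t, continuous l t) ->
  (forall t, in01 t -> Rabs (k t - l t) <= c) ->
  forall t, in01 t -> Rabs (RInt k 0 t - RInt l 0 t) <= c.
Proof.
intros Hk Hl Hc t Ht.
assert (E : forall g : R -> R, RInt g 0 0 = 0) by
  (intros; apply (RInt_point (V := R_CompleteNormedModule))).
replace (RInt k 0 t - RInt l 0 t)
  with (RInt k 0 t - RInt l 0 t - (RInt k 0 0 - RInt l 0 0)) by (rewrite !E; ring).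
apply (derive_bound (fun t => RInt k 0 t - RInt l 0 t) (fun t => k t - l t)); auto.
intros r _. apply (is_derive_minus (fun t => RInt k 0 t) (fun t => RInt l 0 t));
  now apply is_derive_RInt_continuous.
Qed.

Lemma geometric_small (C eps : R) : 0 < eps -> exists n, C * (1 / 2) ^ n < eps.
Proof.
intros He.
assert (Hgeom : is_lim_seq (fun n => C * (1 / 2) ^ n) (C * 0)).
{ apply (is_lim_seq_scal_l _ C 0). apply is_lim_seq_geom. rewrite Rabs_right; lra. }
rewrite Rmult_0_r in Hgeom.
apply is_lim_seq_spec in Hgeom. destruct (Hgeom (mkposreal eps He)) as [N HN].
exists N. specialize (HN N (Nat.le_refl N)). rewrite Rminus_0_r in HN. simpl in HN.
apply Rabs_def2 in HN. lra.
Qed.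

(** * Picard iteration for a contracting integral operator *)

Section Picard.

Variable f : R -> R -> R.
Hypothesis f_continuous :
  forall s : R -> R, (forall t, continuous s t) -> forall t, continuous (fun r => f r (s r)) t.
Hypothesis f_lipschitz :
  forall t x y, in01 t -> Rabs (f t x - f t y) <= Rabs (x - y) / 2.

(** The upper limit [proj01 t] freezes the iterates outside [0,1], where [f] carries no Lipschitz
    bound; the estimates then hold for every real [t]. *)
Fixpoint picard_iterate (y : R) (n : nat) : R -> R :=
  match n with
  | O => fun _ => y
  | S n => fun t => y + RInt (fun r => f r (picard_iterate y n r)) 0 (proj01 t)
  end.

Definition picard_limit (y t : R) : R := real (Lim_seq (fun n => picard_iterate y n t)).

Lemma picard_iterate_continuous y n t : continuous (picard_iterate y n) t.
Proof.
revert t. induction n as [|n IH]; intros t; simpl.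
- apply continuous_const.
- apply continuous_Rplus; [apply continuous_const|].
  apply (continuous_comp proj01 (fun t => RInt (fun r => f r (picard_iterate y n r)) 0 t)).
  + apply nonexpansive_continuous, proj01_lipschitz.
  + eapply is_derive_continuous. apply is_derive_RInt_continuous.
    now apply f_continuous.
Qed.

(** The constant is the maximum of [Rabs (f r y)] over [0,1], which bounds the first step; each
    further step is halved by the contraction. *)
Lemma picard_iterate_step y : exists C, 0 <= C /\ forall n t,
  Rabs (picard_iterate y (S n) t - picard_iterate y n t) <= C * (1 / 2) ^ n.
Proof.
set (g := fun r => f r y).
assert (Hg : forall t, continuous g t).
{ apply (f_continuous (fun _ => y)). intros; apply continuous_const. }
destruct (continuous01_bounded g Hg) as [m [_ Hm]].
exists (Rabs (g m)). split; [apply Rabs_pos|].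
induction n as [|n IH]; intros t.
- simpl picard_iterate. rewrite pow_O, Rmult_1_r.
  replace (y + _ - y) with (RInt g 0 (proj01 t) - RInt (fun _ => 0) 0 (proj01 t)).
  + apply RInt_diff_bound; auto using proj01_in.
    * intros; apply continuous_const.
    * intros r Hr. rewrite Rminus_0_r. now apply Hm.
  + rewrite (RInt_const (V := R_CompleteNormedModule)).
    unfold scal; simpl; unfold mult; simpl. unfold g. ring.
- change (picard_iterate y (S (S n)) t) with
    (y + RInt (fun r => f r (picard_iterate y (S n) r)) 0 (proj01 t)).
  change (picard_iterate y (S n) t) with
    (y + RInt (fun r => f r (picard_iterate y n r)) 0 (proj01 t)).
  match goal with |- Rabs (y + ?a - (y + ?b)) <= _ =>
    replace (y + a - (y + b)) with (a - b) by ring end.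
  apply RInt_diff_bound; auto using proj01_in, picard_iterate_continuous.
  intros r Hr. eapply Rle_trans; [now apply f_lipschitz|].
  specialize (IH r). simpl pow. lra.
Qed.

Lemma picard_iterate_limit y : exists C, 0 <= C /\ forall n t,
  Rabs (picard_limit y t - picard_iterate y n t) <= C * (1 / 2) ^ n.
Proof.
destruct (picard_iterate_step y) as [C [HC Hstep]].
exists (2 * C). split; [lra|].
assert (Hp : forall n, 0 < (1 / 2) ^ n) by (intros; apply pow_lt; lra).
assert (Htail : forall n m t,
  Rabs (picard_iterate y (n + m) t - picard_iterate y n t) <= 2 * C * (1 / 2) ^ n).
{ intros n m t.
  (* The sharper telescoped bound is the one that passes through the induction on [m]. *)
  apply Rle_trans with (2 * C * ((1 / 2) ^ n - (1 / 2) ^ (n + m))).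
  - induction m as [|m IH].
    + rewrite Nat.add_0_r, !Rminus_diag, Rabs_R0. lra.
    + rewrite Nat.add_succ_r. specialize (Hstep (n + m)%nat t).
      replace (picard_iterate y (S (n + m)) t - picard_iterate y n t) with
        ((picard_iterate y (S (n + m)) t - picard_iterate y (n + m) t)
         + (picard_iterate y (n + m) t - picard_iterate y n t)) by ring.
      eapply Rle_trans; [apply Rabs_triang|]. change ((1 / 2) ^ S (n + m)) with
        (1 / 2 * (1 / 2) ^ (n + m)). lra.
  - specialize (Hp (n + m)%nat). nra. }
intros n t.
assert (Hlim : is_lim_seq (fun n => picard_iterate y n t) (picard_limit y t)).
{ apply Lim_seq_correct', ex_lim_seq_cauchy_corr.
  intros eps.
  (* Two iterates are compared through iterate [N], at the price of two tails of size
     [2 * C * (1 / 2) ^ N]. *)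
  assert (Hgeom : is_lim_seq (fun n => 4 * C * (1 / 2) ^ n) (4 * C * 0)).
  { apply (is_lim_seq_scal_l _ (4 * C) 0). apply is_lim_seq_geom.
    rewrite Rabs_right; lra. }
  rewrite Rmult_0_r in Hgeom.
  apply is_lim_seq_spec in Hgeom. destruct (Hgeom eps) as [N HN].
  exists N. intros p q Hpn Hq.
  specialize (HN N (Nat.le_refl N)). rewrite Rminus_0_r in HN.
  pose proof (Rle_abs (4 * C * (1 / 2) ^ N)).
  pose proof (Htail N (p - N)%nat t) as H1. pose proof (Htail N (q - N)%nat t) as H2.
  replace (N + (p - N))%nat with p in H1 by lia.
  replace (N + (q - N))%nat with q in H2 by lia.
  replace (picard_iterate y p t - picard_iterate y q t) with
    ((picard_iterate y p t - picard_iterate y N t)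
     - (picard_iterate y q t - picard_iterate y N t)) by ring.
  eapply Rle_lt_trans; [apply Rabs_triang|]. rewrite Rabs_Ropp. lra. }
set (l := picard_limit y t) in *. clearbody l.
apply (is_lim_seq_incr_n _ n) in Hlim.
apply Rabs_le_between'. split.
- apply (is_lim_seq_le (fun _ => picard_iterate y n t - 2 * C * (1 / 2) ^ n) _ _ _)
    with (2 := is_lim_seq_const _) (3 := Hlim).
  intros m. specialize (Htail n m t). rewrite (Nat.add_comm m n).
  apply Rabs_le_between' in Htail. lra.
- apply (is_lim_seq_le _ (fun _ => picard_iterate y n t + 2 * C * (1 / 2) ^ n) _ _)
    with (2 := Hlim) (3 := is_lim_seq_const _).
  intros m. specialize (Htail n m t). rewrite (Nat.add_comm m n).
  apply Rabs_le_between' in Htail. lra.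
Qed.

(** A uniform limit of continuous functions, by the three-epsilon argument. *)
Lemma picard_limit_continuous y t : continuous (picard_limit y) t.
Proof.
destruct (picard_iterate_limit y) as [C [HC Hlim]].
apply continuousE. intros eps He.
destruct (geometric_small C (eps / 3)) as [n Hn]; [lra|].
destruct (proj1 (continuousE _ _) (picard_iterate_continuous y n t) (eps / 3))
  as [d [Hd0 Hd]]; [lra|].
exists d. split; [exact Hd0|]. intros s Hs.
specialize (Hd s Hs).
pose proof (Hlim n s) as H1. pose proof (Hlim n t) as H2.
apply Rabs_le_between in H1. apply Rabs_le_between in H2. apply Rabs_def2 in Hd.
apply Rabs_def1; lra.
Qed.

(** The limit is within [C / 2 ^ (n + 1)] of iterate [n + 1], whose integral is within [C / 2 ^ n]
    of the integral along the limit; both errors tend to 0. *)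
Lemma picard_limit_fixed y t : in01 t ->
  picard_limit y t = y + RInt (fun r => f r (picard_limit y r)) 0 t.
Proof.
intros Ht.
destruct (picard_iterate_limit y) as [C [HC Hlim]].
apply cond_eq. intros eps He.
destruct (geometric_small (2 * C) eps He) as [n Hn].
pose proof (Hlim (S n) t) as H1. simpl picard_iterate in H1. rewrite (proj01_id t Ht) in H1.
assert (H2 : Rabs (RInt (fun r => f r (picard_iterate y n r)) 0 t
   - RInt (fun r => f r (picard_limit y r)) 0 t) <= C * (1 / 2) ^ n).
{ apply RInt_diff_bound; auto using picard_iterate_continuous, picard_limit_continuous.
  intros r Hr. eapply Rle_trans; [now apply f_lipschitz|].
  specialize (Hlim n r). rewrite Rabs_minus_sym.
  pose proof (Rabs_pos (picard_limit y r - picard_iterate y n r)). lra. }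
change ((1 / 2) ^ S n) with (1 / 2 * (1 / 2) ^ n) in H1.
assert (0 < (1 / 2) ^ n) by (apply pow_lt; lra).
assert (0 <= C * (1 / 2) ^ n) by nra.
apply Rabs_le_between in H1. apply Rabs_le_between in H2.
apply Rabs_def1; lra.
Qed.

Lemma contraction_flow : exists phi : R -> R -> R, forall y,
  (forall t, continuous (phi y) t) /\ phi y 0 = y /\
  forall t, in01 t -> is_derive (phi y) t (f t (phi y t)).
Proof.
(* The right-hand side of the fixed-point equation is taken instead of [picard_limit] itself: it is
   differentiable on both sides at 0 and 1, while the two agree on [0,1]. *)
exists (fun y t => y + RInt (fun r => f r (picard_limit y r)) 0 t).
intros y.
assert (Hd : forall t, is_derive (fun t => y + RInt (fun r => f r (picard_limit y r)) 0 t) t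
  (f t (picard_limit y t))).
{ intros t. replace (f t (picard_limit y t)) with (0 + f t (picard_limit y t)) by ring.
  apply is_derive_Rplus.
  - apply (is_derive_const (K := R_AbsRing) (V := R_NormedModule)).
  - apply (is_derive_RInt_continuous (fun r => f r (picard_limit y r))).
    auto using picard_limit_continuous. }
split; [|split].
- intros t. eapply is_derive_continuous, Hd.
- rewrite (RInt_point (V := R_CompleteNormedModule)). apply Rplus_0_r.
- intros t Ht. rewrite <- (picard_limit_fixed y t Ht). apply Hd.
Qed.

End Picard.

(** * The Poincaré map near a solution *)

(** With no linear term, the field truncated at a small height is a contraction. A solution starting
    at a small [y] stays below [2 * Rabs y], so the truncation never acts on it and its velocity is
    of order [y ^ 2]. *)
Lemma small_solutions (p q : R -> R) :
  (forall t, continuous p t) -> (forall t, continuous q t) ->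
  exists (r C : R) (psi : R -> R -> R), 0 < r /\ 0 <= C /\
    forall y, Rabs y < r ->
      (forall t, in01 t -> is_derive (psi y) t (p t * psi y t ^ 2 + q t * psi y t ^ 3)) /\
      psi y 0 = y /\ Rabs (psi y 1 - y) <= C * y ^ 2.
Proof.
intros Hp Hq.
assert (exists M, 0 <= M /\ forall t, in01 t -> Rabs (p t) <= M /\ Rabs (q t) <= M)
  as [M [HM HpqM]].
{ destruct (continuous01_bounded p Hp) as [m1 [_ H1]].
  destruct (continuous01_bounded q Hq) as [m2 [_ H2]].
  exists (Rmax (Rabs (p m1)) (Rabs (q m2))). split.
  - eapply Rle_trans; [apply Rabs_pos|apply Rmax_l].
  - intros t Ht. split.
    + eapply Rle_trans; [now apply H1|apply Rmax_l].
    + eapply Rle_trans; [now apply H2|apply Rmax_r]. }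
(* Truncating at this height makes the field Lipschitz with constant
   [M * (2 r + 3 r ^ 2) <= 1 / 2]. *)
set (r := 1 / (10 * (M + 1))).
assert (Hr : 0 < r) by (apply Rdiv_lt_0_compat; lra).
assert (Hr1 : r <= 1) by (unfold r; apply Rle_div_l; lra).
assert (HMr : M * r <= 1 / 10).
{ replace (M * r) with (M / (10 * (M + 1))) by (unfold r; field; lra).
  apply Rle_div_l; lra. }
set (f := fun t x => p t * clamp r x ^ 2 + q t * clamp r x ^ 3).
assert (Hlip : forall t x y, in01 t -> Rabs (f t x - f t y) <= Rabs (x - y) / 2).
{ intros t x y Ht. destruct (HpqM t Ht) as [HpM HqM].
  unfold f.
  pose proof (clamp_bound r x (Rlt_le _ _ Hr)) as Hx.
  pose proof (clamp_bound r y (Rlt_le _ _ Hr)) as Hy.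
  pose proof (clamp_lipschitz r x y) as Hxy.
  set (u := clamp r x) in *. set (v := clamp r y) in *.
  replace (p t * u ^ 2 + q t * u ^ 3 - (p t * v ^ 2 + q t * v ^ 3))
    with ((u - v) * (p t * (u + v) + q t * (u * u + u * v + v * v))) by ring.
  rewrite Rabs_mult.
  assert (Huv : Rabs (u + v) <= 2 * r) by (eapply Rle_trans; [apply Rabs_triang|lra]).
  assert (Hprod : forall a b, Rabs a <= r -> Rabs b <= r -> Rabs (a * b) <= r * r).
  { intros a b Ha Hb. rewrite Rabs_mult.
    apply Rmult_le_compat; auto using Rabs_pos. }
  assert (Huv2 : Rabs (u * u + u * v + v * v) <= 3 * (r * r)).
  { pose proof (Hprod u u Hx Hx). pose proof (Hprod u v Hx Hy). pose proof (Hprod v v Hy Hy).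
    eapply Rle_trans; [apply Rabs_triang|].
    pose proof (Rabs_triang (u * u) (u * v)). lra. }
  assert (Hslope : Rabs (p t * (u + v) + q t * (u * u + u * v + v * v)) <= 1 / 2).
  { eapply Rle_trans; [apply Rabs_triang|]. rewrite !Rabs_mult.
    apply Rle_trans with (M * (2 * r) + M * (3 * (r * r))); [|nra].
    apply Rplus_le_compat; apply Rmult_le_compat; auto using Rabs_pos. }
  pose proof (Rabs_pos (u - v)).
  apply Rle_trans with (Rabs (u - v) * (1 / 2)); [|lra].
  now apply Rmult_le_compat_l. }
assert (Hcont : forall s : R -> R, (forall t, continuous s t) ->
  forall t, continuous (fun t => f t (s t)) t).
{ intros s Hs t. unfold f.
  assert (Hcs : forall t, continuous (fun t => clamp r (s t)) t).
  { intros t'. apply (continuous_comp s (clamp r)); [apply Hs|].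
    apply nonexpansive_continuous, clamp_lipschitz. }
  continuity_of_terms; apply Hcs. }
destruct (contraction_flow f Hcont Hlip) as [psi Hpsi].
(* Starting below [r / 2] keeps the solution, bounded by twice its initial size, within the
   truncation height. The final estimate gives [8 * M * y ^ 2], so [12 * M] is ample. *)
exists (r / 2), (12 * M), psi. split; [lra|]. split; [lra|].
intros y Hy. destruct (Hpsi y) as [Hc [H0 Hd]].
assert (Hf0 : forall t x, in01 t -> Rabs (f t x) <= Rabs x / 2).
{ intros t x Ht. specialize (Hlip t x 0 Ht).
  replace (f t 0) with 0 in Hlip.
  - now rewrite !Rminus_0_r in Hlip.
  - unfold f. rewrite clamp_id; [ring|rewrite Rabs_R0; lra]. }
(* At a maximum point [m] of [Rabs (psi y t)], the displacement from [y] is at most half of the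
   maximum, which can be absorbed on the left. *)
assert (Hbound : forall t, in01 t -> Rabs (psi y t) <= 2 * Rabs y).
{ destruct (continuous01_bounded (psi y) Hc) as [m [Hm Hmax]].
  assert (Hm' : Rabs (psi y m) <= 2 * Rabs y).
  { pose proof (derive_bound (psi y) _ (Rabs (psi y m) / 2) Hd) as H.
    specialize (H ltac:(intros t Ht; eapply Rle_trans; [now apply Hf0|];
      specialize (Hmax t Ht); lra) m Hm).
    rewrite H0 in H. pose proof (Rabs_triang_inv (psi y m) y). lra. }
  intros t Ht. eapply Rle_trans; [now apply Hmax|exact Hm']. }
assert (Hd' : forall t, in01 t ->
  is_derive (psi y) t (p t * psi y t ^ 2 + q t * psi y t ^ 3)).
{ intros t Ht. specialize (Hd t Ht). unfold f in Hd.
  rewrite clamp_id in Hd; [exact Hd|]. specialize (Hbound t Ht). lra. }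
split; [exact Hd'|]. split; [exact H0|].
rewrite <- H0 at 2.
apply (derive_bound (psi y) _ (12 * M * y ^ 2) Hd'); [|unfold in01; lra].
intros t Ht. destruct (HpqM t Ht) as [HpM HqM]. specialize (Hbound t Ht).
eapply Rle_trans; [apply Rabs_triang|]. rewrite !Rabs_mult, <- !RPow_abs.
rewrite <- (pow2_abs y).
set (s := Rabs (psi y t)) in *. set (h := Rabs y) in *.
assert (0 <= s) by apply Rabs_pos. assert (0 <= h) by apply Rabs_pos.
assert (Hs2 : s ^ 2 <= 4 * h ^ 2) by nra.
assert (Hs3 : s ^ 3 <= 4 * h ^ 2).
{ replace (s ^ 3) with (s * s ^ 2) by ring. nra. }
apply Rle_trans with (M * (4 * h ^ 2) + M * (4 * h ^ 2)); [|nra].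
apply Rplus_le_compat; apply Rmult_le_compat; auto using Rabs_pos; nra.
Qed.

Lemma is_derive_exp_comp (K : R -> R) (t k : R) :
  is_derive K t k -> is_derive (fun s => exp (K s)) t (k * exp (K t)).
Proof. intros HK. apply (is_derive_comp exp K); [apply is_derive_exp|exact HK]. Qed.

(* Substituting [x + exp K * s] for the unknown cancels the linear part of the equation and
   leaves an equation of the same type for [s], whose time-one map is [s + O (s ^ 2)]. *)
Lemma poincare_map_derivative (A B x K : R -> R) :
  (forall t, continuous A t) -> (forall t, continuous B t) ->
  regular_solution A B x ->
  (forall t, is_derive K t (3 * A t * x t ^ 2 + 2 * B t * x t)) -> K 0 = 0 ->
  exists (eps : R) (P : R -> R), 0 < eps /\
    (forall y, Rabs (y - x 0) < eps -> exists z : R -> R,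
       (forall t, in01 t -> is_derive z t (A t * z t ^ 3 + B t * z t ^ 2)) /\
       z 0 = y /\ z 1 = P y) /\
    is_derive P (x 0) (exp (K 1)).
Proof.
intros HA HB [Hcx Hx] HK HK0.
set (E := fun t => exp (K t)).
assert (HE : forall t, continuous E t).
{ intros t. eapply is_derive_continuous, is_derive_exp_comp, HK. }
destruct (small_solutions (fun t => (3 * A t * x t + B t) * E t) (fun t => A t * E t ^ 2))
  as [r [C [psi [Hr [HC Hpsi]]]]].
{ intros t; continuity_of_terms. }
{ intros t; continuity_of_terms. }
exists r, (fun y => x 1 + E 1 * psi (y - x 0) 1). split; [exact Hr|]. split.
- intros y Hy. destruct (Hpsi (y - x 0) Hy) as [Hd [H0 _]].
  set (s := psi (y - x 0)) in *.
  exists (fun t => x t + E t * s t). split; [|split].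
  + intros t Ht.
    replace (A t * (x t + E t * s t) ^ 3 + B t * (x t + E t * s t) ^ 2) with
      ((A t * x t ^ 3 + B t * x t ^ 2) +
       ((3 * A t * x t ^ 2 + 2 * B t * x t) * E t * s t
        + E t * ((3 * A t * x t + B t) * E t * s t ^ 2 + A t * E t ^ 2 * s t ^ 3))) by ring.
    apply is_derive_Rplus; [now apply Hx|].
    apply is_derive_Rmult; [apply is_derive_exp_comp, HK|now apply Hd].
  + unfold E. rewrite H0, HK0, exp_0. ring.
  + reflexivity.
- apply is_deriveE. intros eps He.
  change (exp (K 1)) with (E 1).
  assert (HE1 : 0 < E 1) by apply exp_pos.
  assert (Hpos : 0 < E 1 * (C + 1)) by nra.
  (* The error of the difference quotient is at most [E 1 * C * Rabs (y - x 0)]; writing [C + 1]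
     keeps the divisor positive when [C = 0]. *)
  exists (Rmin r (eps / (E 1 * (C + 1)))). split.
  { apply Rmin_pos; [exact Hr|now apply Rdiv_lt_0_compat]. }
  intros y Hne Hy.
  assert (Hy1 : Rabs (y - x 0) < r) by (eapply Rlt_le_trans; [exact Hy|apply Rmin_l]).
  assert (Hy2 : Rabs (y - x 0) < eps / (E 1 * (C + 1)))
    by (eapply Rlt_le_trans; [exact Hy|apply Rmin_r]).
  rewrite Rminus_diag.
  (* The quadratic bound at initial value 0 forces [psi 0 1 = 0], so the map sends [x 0] to
     [x 1]. *)
  destruct (Hpsi 0) as [_ [_ H00]]; [rewrite Rabs_R0; exact Hr|].
  assert (Hpsi0 : psi 0 1 = 0).
  { rewrite Rminus_0_r in H00. replace (C * 0 ^ 2) with 0 in H00 by ring.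
    pose proof (Rabs_pos (psi 0 1)). apply Rabs_eq_0. lra. }
  rewrite Hpsi0.
  destruct (Hpsi (y - x 0) Hy1) as [_ [_ Hq]].
  set (h := y - x 0) in *.
  assert (Hh : h <> 0) by (unfold h; lra).
  replace ((x 1 + E 1 * psi h 1 - (x 1 + E 1 * 0)) / h - E 1)
    with (E 1 * (psi h 1 - h) / h) by (field; exact Hh).
  unfold Rdiv. rewrite !Rabs_mult, (Rabs_right (E 1)), Rabs_inv by lra.
  rewrite <- (pow2_abs h) in Hq.
  set (k := Rabs h) in *.
  assert (Hk : 0 < k) by now apply Rabs_pos_lt.
  apply Rlt_div_r in Hy2; [|exact Hpos].
  apply Rle_lt_trans with (E 1 * (C * k)); [|nra].
  rewrite Rmult_assoc. apply Rmult_le_compat_l; [lra|].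
  apply Rle_div_l; [exact Hk|]. lra.
Qed.

(** * Periodic orbits under the sign condition *)

(** The integrating factor [exp (- K)] makes the product with [w] constant. *)
Lemma linear_homogeneous (w k K : R -> R) :
  (forall t, in01 t -> is_derive w t (k t * w t)) ->
  (forall t, is_derive K t (k t)) -> K 0 = 0 ->
  forall t, in01 t -> w t = w 0 * exp (K t).
Proof.
intros Hw HK HK0 t Ht.
assert (H : w t * exp (- K t) = w 0 * exp (- K 0)).
{ apply (zero_derive_constant (fun t => w t * exp (- K t))); [|exact Ht].
  intros s Hs.
  replace 0 with (k s * w s * exp (- K s) + w s * (- k s * exp (- K s))) by ring.
  apply (is_derive_Rmult w (fun t => exp (- K t))); [now apply Hw|].
  apply (is_derive_exp_comp (fun t => - K t)), (is_derive_opp K), HK. }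
rewrite HK0, Ropp_0, exp_0, Rmult_1_r in H.
rewrite <- H, Rmult_assoc, <- exp_plus, Rplus_opp_l, exp_0. ring.
Qed.

Lemma linear_homogeneous_exists (w k : R -> R) :
  (forall t, continuous k t) ->
  (forall t, in01 t -> is_derive w t (k t * w t)) ->
  exists K : R -> R, forall t, in01 t -> w t = w 0 * exp (K t).
Proof.
intros Hk Hw. destruct (continuous_primitive k Hk) as [K [HK0 HK]].
exists K. now apply linear_homogeneous with k.
Qed.

(** Along [x] itself the equation reads [x' = (A x ^ 2 + B x) x], which is linear homogeneous, so
    one zero would force [x] to vanish on all of [0,1]. *)
Lemma regular_solution_nonzero (A B x : R -> R) :
  (forall t, continuous A t) -> (forall t, continuous B t) ->
  regular_solution A B x -> (exists t, in01 t /\ x t <> 0) ->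
  forall t, in01 t -> x t <> 0.
Proof.
intros HA HB [Hc Hx] [t0 [Ht0 Hxt0]].
destruct (linear_homogeneous_exists x (fun t => A t * x t ^ 2 + B t * x t)) as [K HK].
- intros t; continuity_of_terms.
- intros t Ht. replace ((A t * x t ^ 2 + B t * x t) * x t)
    with (A t * x t ^ 3 + B t * x t ^ 2) by ring. now apply Hx.
- intros t Ht E. rewrite (HK t Ht) in E. apply Rmult_integral in E.
  pose proof (exp_pos (K t)). destruct E as [E|E]; [|lra].
  apply Hxt0. rewrite (HK t0 Ht0), E. ring.
Qed.

(** The difference of the two cubic fields is divisible by [x - y]. This gives uniqueness, and also
    that [x - y] keeps its initial sign. *)
Lemma regular_solution_diff (A B x y : R -> R) :
  (forall t, continuous A t) -> (forall t, continuous B t) ->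
  regular_solution A B x -> regular_solution A B y ->
  exists K : R -> R, forall t, in01 t -> x t - y t = (x 0 - y 0) * exp (K t).
Proof.
intros HA HB [Hcx Hx] [Hcy Hy].
apply (linear_homogeneous_exists (fun t => x t - y t)
  (fun t => A t * (x t ^ 2 + x t * y t + y t ^ 2) + B t * (x t + y t))).
- intros t; continuity_of_terms.
- intros t Ht.
  replace (_ * (x t - y t)) with
    (A t * x t ^ 3 + B t * x t ^ 2 - (A t * y t ^ 3 + B t * y t ^ 2)) by ring.
  apply (is_derive_minus x y); [now apply Hx|now apply Hy].
Qed.

Section Transversal.

Variables (A B : R -> R) (a b t0 : R).
Hypothesis A_continuous : forall t, continuous A t.
Hypothesis B_continuous : forall t, continuous B t.
Hypothesis D_nonneg : forall t, in01 t -> 0 <= a * A t + b * B t.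
Hypothesis t0_in01 : in01 t0.
Hypothesis D_t0 : a * A t0 + b * B t0 <> 0.

(* [v = a - b x] satisfies [v' = A x ^ 2 v - x ^ 2 (a A + b B)], so [v exp (- K)] is
   nonincreasing and strictly smaller at 1 than at 0. *)
Lemma periodic_transversal (x K : R -> R) :
  regular_solution A B x -> x 0 = x 1 -> (forall t, in01 t -> x t <> 0) ->
  (forall t, is_derive K t (A t * x t ^ 2)) -> K 0 = 0 ->
  K 1 <> 0 /\
  ((forall t, in01 t -> 0 < a - b * x t) \/ (forall t, in01 t -> a - b * x t < 0)).
Proof.
intros [Hc Hx] Hper Hnz HK HK0.
set (m := fun t => - ((a - b * x t) * exp (- K t))).
set (dm := fun t => (a * A t + b * B t) * (x t ^ 2 * exp (- K t))).
assert (Hm : forall t, in01 t -> is_derive m t (dm t)).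
{ intros t Ht.
  replace (dm t) with (- (- (b * (A t * x t ^ 3 + B t * x t ^ 2)) * exp (- K t)
    + (a - b * x t) * (- (A t * x t ^ 2) * exp (- K t)))) by (unfold dm; ring).
  apply (is_derive_opp (fun t => (a - b * x t) * exp (- K t))),
    (is_derive_Rmult (fun t => a - b * x t) (fun t => exp (- K t))).
  - replace (- (b * (A t * x t ^ 3 + B t * x t ^ 2)))
      with (0 + - (b * (A t * x t ^ 3 + B t * x t ^ 2))) by ring.
    apply is_derive_Rplus.
    + apply (is_derive_const (K := R_AbsRing) (V := R_NormedModule)).
    + apply (is_derive_opp (fun t => b * x t)), (is_derive_scal x). now apply Hx.
  - apply (is_derive_exp_comp (fun t => - K t)), (is_derive_opp K), HK. }
assert (Hpos : forall t, in01 t -> 0 < x t ^ 2 * exp (- K t)).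
{ intros t Ht. apply Rmult_lt_0_compat; [|apply exp_pos].
  apply pow2_gt_0. now apply Hnz. }
assert (Hdm : forall t, in01 t -> 0 <= dm t).
{ intros t Ht. specialize (Hpos t Ht). specialize (D_nonneg t Ht).
  unfold dm. now apply Rmult_le_pos; [|apply Rlt_le]. }
assert (Hlt : m 0 < m 1).
{ apply (nonneg_derive_lt m dm t0); auto.
  unfold dm. specialize (Hpos t0 t0_in01). apply Rmult_integral_contrapositive_currified; lra. }
pose proof (nonneg_derive_nondecreasing m dm Hm Hdm) as Hmono.
assert (Hm0 : m 0 = - (a - b * x 0)) by (unfold m; rewrite HK0, Ropp_0, exp_0; ring).
assert (Hm1 : m 1 = - (a - b * x 0) * exp (- K 1)) by (unfold m; rewrite <- Hper; ring).
split.
{ intros HK1. rewrite HK1, Ropp_0, exp_0 in Hm1. lra. }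
pose proof (exp_pos (- K 1)) as He1.
(* As [m] is nondecreasing, a negative initial value of [v] propagates forward from 0, and a
   positive one propagates backward from 1, where periodicity gives [v] the same value. The value 0
   would give [m 0 = m 1]. *)
destruct (Rtotal_order (a - b * x 0) 0) as [Hv|[Hv|Hv]].
- right. intros t [Ht1 Ht2]. specialize (Hmono 0 t (Rle_refl 0) Ht1 Ht2).
  rewrite Hm0 in Hmono. unfold m in Hmono. pose proof (exp_pos (- K t)). nra.
- rewrite Hv in Hm0, Hm1. lra.
- left. intros t [Ht1 Ht2]. specialize (Hmono t 1 Ht1 Ht2 (Rle_refl 1)).
  rewrite Hm1 in Hmono. unfold m in Hmono. pose proof (exp_pos (- K t)). nra.
Qed.

Lemma periodic_variational_integral (x K : R -> R) :
  regular_solution A B x -> x 0 = x 1 -> (forall t, in01 t -> x t <> 0) ->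
  (forall t, is_derive K t (3 * A t * x t ^ 2 + 2 * B t * x t)) -> K 0 = 0 ->
  K 1 <> 0.
Proof.
intros Hreg Hper Hnz HK HK0.
destruct Hreg as [Hc Hx].
destruct (continuous_primitive (fun t => A t * x t ^ 2 + B t * x t)) as [J [HJ0 HJ]].
{ intros t; continuity_of_terms. }
assert (HJ1 : J 1 = 0).
{ assert (E : x 1 = x 0 * exp (J 1)).
  { apply (linear_homogeneous x (fun t => A t * x t ^ 2 + B t * x t)); auto.
    - intros t Ht. replace ((A t * x t ^ 2 + B t * x t) * x t)
        with (A t * x t ^ 3 + B t * x t ^ 2) by ring. now apply Hx.
    - unfold in01; lra. }
  assert (Hx0 : x 0 <> 0) by (apply Hnz; unfold in01; lra).
  apply exp_inv. rewrite exp_0. apply Rmult_eq_reg_l with (x 0); [lra|exact Hx0]. }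
(* Removing twice the integral of [x' / x] leaves a primitive of [A x ^ 2] with the same value at 1,
   because [J 1 = 0]. *)
destruct (periodic_transversal x (fun t => K t - 2 * J t)) as [H _]; auto.
- now split.
- intros t. replace (A t * x t ^ 2) with
    (3 * A t * x t ^ 2 + 2 * B t * x t - 2 * (A t * x t ^ 2 + B t * x t)) by ring.
  apply (is_derive_minus K (fun t => 2 * J t)); [apply HK|]. apply (is_derive_scal J), HJ.
- rewrite HK0, HJ0. ring.
- rewrite HJ1 in H. lra.
Qed.

Lemma transversal_coefficients_nonzero : a <> 0 \/ b <> 0.
Proof.
destruct (Req_dec a 0) as [Ha|Ha]; [|now left].
right. intros Hb. apply D_t0. rewrite Ha, Hb. ring.
Qed.

(* The time function of the autonomous equation [x' = x ^ 2 (a - b x)]. *)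
Lemma time_function : exists G : R -> R, forall x, x <> 0 -> a - b * x <> 0 ->
  is_derive G x (/ (x ^ 2 * (a - b * x))).
Proof.
destruct (Req_dec a 0) as [Ha|Ha].
- assert (Hb : b <> 0) by (destruct transversal_coefficients_nonzero; auto).
  exists (fun x => / (2 * b * x ^ 2)). intros x Hx _.
  auto_derive.
  + repeat apply Rmult_integral_contrapositive_currified; lra.
  + rewrite Ha. field. lra.
(* Partial fractions: [1 / (a x ^ 2) + b / (a ^ 2 x) + b ^ 2 / (a ^ 2 (a - b x))]. Half the
   logarithm of a square stands for the logarithm of an absolute value. *)
- exists (fun x => - / (a * x) + b / a ^ 2 * ((ln (x ^ 2) - ln ((a - b * x) ^ 2)) / 2)).
  intros x Hx Hv.
  pose proof (pow2_gt_0 x Hx). pose proof (pow2_gt_0 (a - b * x) Hv).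
  auto_derive.
  + replace (a + - (b * x)) with (a - b * x) by ring.
    repeat split; try lra.
    now apply Rmult_integral_contrapositive_currified.
  + field. lra.
Qed.

(** Encoding a constant sign as a multiplier lets the sign combinations of two functions be treated
    at once. *)
Lemma same_sign_cases (f : R -> R) :
  (forall t, in01 t -> 0 < f t) \/ (forall t, in01 t -> f t < 0) ->
  exists c, forall t, in01 t -> 0 < c * f t.
Proof.
intros [H|H]; [exists 1|exists (-1)]; intros t Ht; specialize (H t Ht); lra.
Qed.

(* Along two solutions the time functions satisfy
   [(G x - G y)' = (x - y) (a A + b B) / ((a - b x) (a - b y))]. *)
Lemma periodic_unique (x y : R -> R) :
  regular_solution A B x -> x 0 = x 1 -> (forall t, in01 t -> x t <> 0) ->
  regular_solution A B y -> y 0 = y 1 -> (forall t, in01 t -> y t <> 0) ->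
  forall t, in01 t -> x t = y t.
Proof.
intros Hx Hxper Hxnz Hy Hyper Hynz.
destruct (regular_solution_diff A B x y) as [K HK]; auto.
destruct (Req_dec (x 0) (y 0)) as [E0|Hne].
{ intros t Ht. specialize (HK t Ht). rewrite E0 in HK. lra. }
exfalso.
assert (Hsign : forall z : R -> R, regular_solution A B z -> z 0 = z 1 ->
  (forall t, in01 t -> z t <> 0) ->
  exists c, forall t, in01 t -> 0 < c * (a - b * z t)).
{ intros z Hz Hzper Hznz. apply same_sign_cases.
  destruct (continuous_primitive (fun t => A t * z t ^ 2)) as [L [HL0 HL]].
  { destruct Hz as [Hzc _]. intros t; continuity_of_terms. }
  now apply (periodic_transversal z L). }
destruct (Hsign x) as [c1 H1]; auto. destruct (Hsign y) as [c2 H2]; auto.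
(* This factor carries the signs of [x - y], [a - b x] and [a - b y], so that [g] is positive
   whatever they are. *)
set (c := (x 0 - y 0) * c1 * c2).
set (g := fun t => c * ((x t - y t) / ((a - b * x t) * (a - b * y t)))).
assert (Hg : forall t, in01 t -> 0 < g t).
{ intros t Ht. specialize (H1 t Ht). specialize (H2 t Ht). unfold g, c. rewrite (HK t Ht).
  set (v := a - b * x t) in *. set (w := a - b * y t) in *.
  assert (v <> 0) by (intros E; rewrite E in H1; lra).
  assert (w <> 0) by (intros E; rewrite E in H2; lra).
  replace (_ * _) with ((x 0 - y 0) ^ 2 * exp (K t) * ((c1 * v) * (c2 * w)) / (v ^ 2 * w ^ 2))
    by (field; auto).
  assert (0 < (x 0 - y 0) ^ 2) by (apply pow2_gt_0; lra).
  assert (0 < v ^ 2) by now apply pow2_gt_0.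
  assert (0 < w ^ 2) by now apply pow2_gt_0.
  apply Rdiv_lt_0_compat; auto using Rmult_lt_0_compat, exp_pos. }
destruct time_function as [G HG].
set (F := fun t => c * (G (x t) - G (y t))).
assert (HF : F 0 < F 1).
{ apply (nonneg_derive_lt F (fun t => g t * (a * A t + b * B t)) t0); auto.
  - intros t Ht. unfold F.
    assert (Hv : a - b * x t <> 0) by (intros E; specialize (H1 t Ht); rewrite E in H1; lra).
    assert (Hw : a - b * y t <> 0) by (intros E; specialize (H2 t Ht); rewrite E in H2; lra).
    replace (g t * (a * A t + b * B t)) with
      (c * ((A t * x t ^ 3 + B t * x t ^ 2) * / (x t ^ 2 * (a - b * x t))
          - (A t * y t ^ 3 + B t * y t ^ 2) * / (y t ^ 2 * (a - b * y t))))
      by (unfold g; field; auto).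
    apply (is_derive_scal (fun t => G (x t) - G (y t))).
    apply (is_derive_minus (fun t => G (x t)) (fun t => G (y t)));
      [apply (is_derive_comp G x)|apply (is_derive_comp G y)];
      try (now apply HG; auto); [now apply (proj2 Hx)|now apply (proj2 Hy)].
  - intros t Ht. specialize (Hg t Ht). specialize (D_nonneg t Ht).
    apply Rmult_le_pos; lra.
  - specialize (Hg t0 t0_in01). apply Rmult_integral_contrapositive_currified; lra. }
unfold F in HF. rewrite <- Hxper, <- Hyper in HF. lra.
Qed.

End Transversal.

(** * Passage from data on the unit interval to the line, and conclusion *)

Lemma abel_solution_ext (A B A' B' x : R -> R) :
  (forall t, in01 t -> A' t = A t) -> (forall t, in01 t -> B' t = B t) ->
  abel_solution A B x -> abel_solution A' B' x.
Proof. intros HA HB Hx t Ht. rewrite HA, HB by exact Ht. now apply Hx. Qed.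

Lemma smooth_on01_continuous (f : R -> R) :
  smooth_on01 f -> exists g : R -> R, (forall t, continuous g t) /\
    forall t, in01 t -> g t = f t.
Proof.
intros [g [Hg E]]. exists g. split; [|exact E].
intros t. apply (ex_derive_continuous g). exact (Hg 1%nat t).
Qed.

Theorem theoremA (A B : R -> R) (a b : R) :
  smooth_on01 A -> smooth_on01 B ->
  (exists t, in01 t /\ a * A t + b * B t <> 0) ->
  ((forall t, in01 t -> 0 <= a * A t + b * B t) \/
   (forall t, in01 t -> a * A t + b * B t <= 0)) ->
  (forall x y : R -> R,
     periodic_orbit A B x -> nonzero_on01 x ->
     periodic_orbit A B y -> nonzero_on01 y ->
     forall t, in01 t -> x t = y t) /\
  (forall x : R -> R,
     periodic_orbit A B x -> nonzero_on01 x -> hyperbolic_at A B (x 0)).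
Proof.
intros HA HB [t0 [Ht0 HD0]] Hsign.
destruct (smooth_on01_continuous A HA) as [A' [HcA EA]].
destruct (smooth_on01_continuous B HB) as [B' [HcB EB]].
(* When the combination is nonpositive, [a] and [b] are both negated. *)
assert (exists a' b', (forall t, in01 t -> 0 <= a' * A' t + b' * B' t) /\
  a' * A' t0 + b' * B' t0 <> 0) as [a' [b' [HD HD0']]].
{ destruct Hsign as [H|H].
  - exists a, b. rewrite (EA t0 Ht0), (EB t0 Ht0). split; [|exact HD0].
    intros t Ht. rewrite (EA t Ht), (EB t Ht). now apply H.
  - exists (- a), (- b). rewrite (EA t0 Ht0), (EB t0 Ht0). split; [|lra].
    intros t Ht. rewrite (EA t Ht), (EB t Ht). specialize (H t Ht). lra. }
assert (H0 : in01 0) by (unfold in01; lra).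
assert (H1 : in01 1) by (unfold in01; lra).
assert (Hreg : forall x, periodic_orbit A B x -> nonzero_on01 x ->
  exists X, regular_solution A' B' X /\ X 0 = X 1 /\ (forall t, in01 t -> X t <> 0) /\
    forall t, in01 t -> X t = x t).
{ intros x [Hx Hper] [s [Hs Hxs]].
  destruct (abel_solution_regular A' B' x) as [X [HX E]]; auto.
  { now apply (abel_solution_ext A B). }
  exists X. split; [exact HX|]. split; [now rewrite !E|]. split; [|exact E].
  apply (regular_solution_nonzero A' B'); auto. exists s. now rewrite E. }
split.
- intros x y Hx Hxnz Hy Hynz t Ht.
  destruct (Hreg x Hx Hxnz) as [X [HX [HXper [HXnz EX]]]].
  destruct (Hreg y Hy Hynz) as [Y [HY [HYper [HYnz EY]]]].
  rewrite <- (EX t Ht), <- (EY t Ht).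
  now apply (periodic_unique A' B' a' b' t0).
- intros x Hx Hxnz.
  destruct (Hreg x Hx Hxnz) as [X [HX [HXper [HXnz EX]]]].
  destruct (continuous_primitive (fun t => 3 * A' t * X t ^ 2 + 2 * B' t * X t))
    as [K [HK0 HK]].
  { destruct HX as [HcX _]. intros t; continuity_of_terms. }
  destruct (poincare_map_derivative A' B' X K) as [eps [P [Heps [HP HdP]]]]; auto.
  rewrite <- (EX 0 H0).
  exists eps, P, (exp (K 1)). split; [exact Heps|]. split; [|split; [exact HdP|]].
  + intros y Hy. destruct (HP y Hy) as [z [Hz [Hz0 Hz1]]].
    exists z. split; [|now split].
    intros t Ht. rewrite <- (EA t Ht), <- (EB t Ht).
    apply (is_derive_has_deriv01 z); auto.
  (* A multiplier [exp (K 1) = 1] would mean [K 1 = 0]. *)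
  + intros E. apply (periodic_variational_integral A' B' a' b' t0 HcA HcB HD Ht0 HD0' X K); auto.
    apply exp_inv. now rewrite exp_0.
Qed.
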